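(* Let $N\ge 1$ be an integer, $\sigma>0$, $R>0$, $Z_0\in\mathbb{R}$, and let $b:[0,\infty)\to[0,\infty)$ be continuous and nondecreasing with $0<b(x)\le x^2$ for all $x>0$. Let $u\in C^2([0,R])$ be the positive solution of $$u''(r)+\frac{N-1}{r}u'(r)=\frac{1}{\sigma^4}b(r)u(r)\quad(0<r\le R),\qquad u'(0)=0,\qquad u(R)=e^{-Z_0/(2\sigma^2)},$$ and let $z(x)=h(|x|)$ with $h(r)=-2\sigma^2\ln u(r)$ for $0\le r\le R$, so that $z$ solves $$-\frac{\sigma^2}{2}\Delta z(x)-b(|x|)=-\frac14|\nabla z(x)|^2\quad\text{for }|x|<R,\qquad z(x)=Z_0\quad\text{for }|x|=R.\qquad( * )$$ Then the optimal control $$p^*(x)=-\frac12\nabla z(x)$$ is uniquely determined and satisfies the following properties: 1. (Radial symmetry) The control is radially symmetric, that is, $p^*(x)=-\frac12 h'(|x|)\frac{x}{|x|}$. 2. (Monotonicity) The magnitude $|p^*(x)|=-\frac12 h'(|x|)$ is strictly increasing in $|x|$. This follows from the concavity of $z$ (or equivalently the convexity of $u$). 3. (Uniqueness) Uniqueness of the value function $z$ (given the equation in $( * )$ with the prescribed boundary condition) and of its derivative implies that the feedback law $x\mapsto p^*(x)$ is unique.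
   Context: Background: an inventory process $y(t)\in\mathbb{R}^N$ evolves by $dy(t)=p(t)\,dt+\sigma\,dw(t)$, with $w$ an $N$-dimensional standard Brownian motion, and is stopped at $\tau=\inf\{t>0:|y(t)|\ge R\}$; the cost to be minimized over controls $p$ is $J(p)=E\int_0^\tau\left[|p(t)|^2+b(|y(t)|)\right]dt$. The Hamilton–Jacobi–Bellman equation is $$\inf_{p\in\mathbb{R}^N}\left\{p\cdot\nabla z(x)+\frac{\sigma^2}{2}\Delta z(x)+|p|^2+b(|x|)\right\}=0,\qquad |x|<R,$$ which is equivalent to the equation in $( * )$ in the claim. The ''value function'' is the function $z$ of the claim, solving this equation with boundary value $Z_0$ on $|x|=R$, and the ''optimal control'' (or ''feedback law'') is $p^*(x)=-\frac12\nabla z(x)$, the pointwise minimizer in $p$ of the expression in braces. Concavity of $z$ refers to concavity of $h$ in the radial variable $r=|x|$. *)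

(* Defs.v *)
From mathcomp Require Import all_boot all_order all_algebra.
From mathcomp Require Import all_classical all_reals all_analysis.

Set Implicit Arguments.
Unset Strict Implicit.
Unset Printing Implicit Defensive.

Import Order.TTheory GRing.Theory Num.Theory.
Import numFieldNormedType.Exports.

Local Open Scope classical_set_scope.
Local Open Scope ring_scope.

Section OneVariable.
Context {R : realType}.
Implicit Types (A : set R) (f : R -> R) (r : R).

(* Derivatives relative to a set: two-sided at interior points of an interval,
   one-sided at the endpoints that belong to it. The library derivative f^`()
   is always two-sided, hence unsuitable for C^2([0, rho]). *)
Definition derivable_within A f r : Prop :=
  cvg ((fun s => (s - r)^-1 * (f s - f r)) @ within A r^').

Definition derive_within A f r : R :=
  lim ((fun s => (s - r)^-1 * (f s - f r)) @ within A r^').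

Definition C2_within A f : Prop :=
  let f' := derive_within A f in
  let f'' := derive_within A f' in
  [/\ {in A, forall r, derivable_within A f r},
      {in A, forall r, derivable_within A f' r} &
      [/\ {within A, continuous f}, {within A, continuous f'}
        & {within A, continuous f''}]].

Definition radial_solution (N : nat) (sigma rho Z0 : R) (b u : R -> R) : Prop :=
  let A := `[0, rho]%classic in
  let u' := derive_within A u in
  let u'' := derive_within A u' in
  [/\ C2_within A u,
      {in A, forall r, 0 < u r},
      {in `]0, rho]%classic, forall r,
        u'' r + (N%:R - 1) / r * u' r = b r * u r / sigma ^+ 4},
      u' 0 = 0
    & u rho = expR (- Z0 / (2 * sigma ^+ 2))].

End OneVariable.

Section SeveralVariables.
Context {R : realType} {N : nat}.
Implicit Types (x p q : 'rV[R]_N) (z : 'rV[R]_N -> R).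

Definition dot p q : R := \sum_(i < N) p ord0 i * q ord0 i.

(* The library norm `|x| on 'rV[R]_N is the sup norm; it induces the same
   topology but is not the norm meant here. *)
Definition enorm x : R := Num.sqrt (dot x x).

Definition partial (i : 'I_N) z : 'rV[R]_N -> R := 'D_(delta_mx ord0 i) z.

Definition grad z x : 'rV[R]_N := \row_i partial i z x.

Definition laplacian z x : R := \sum_(i < N) partial i (partial i z) x.

Definition C2_on (U : set 'rV[R]_N) z : Prop :=
  forall x, U x ->
  [/\ {for x, continuous z},
      forall i, derivable z x (delta_mx ord0 i) /\
                {for x, continuous (partial i z)}
    & forall i j, derivable (partial i z) x (delta_mx ord0 j) /\
                  {for x, continuous (partial j (partial i z))}].

Definition HJB_solution (sigma rho Z0 : R) (b : R -> R) z : Prop :=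
  [/\ C2_on [set x | enorm x < rho] z,
      {within [set x | enorm x <= rho], continuous z},
      forall x, enorm x < rho ->
        - (sigma ^+ 2 / 2) * laplacian z x - b (enorm x)
        = - (1 / 4) * enorm (grad z x) ^+ 2
    & forall x, enorm x = rho -> z x = Z0].

(* The expression whose infimum over p appears in the
   Hamilton-Jacobi-Bellman equation. *)
Definition HJB_expr (sigma : R) (b : R -> R) z x p : R :=
  dot p (grad z x) + sigma ^+ 2 / 2 * laplacian z x
  + enorm p ^+ 2 + b (enorm x).

Definition feedback z x : 'rV[R]_N := - (1 / 2) *: grad z x.

End SeveralVariables.

(* Main.v *)
Require Import Defs.
From mathcomp Require Import all_boot all_order all_algebra.
From mathcomp Require Import all_classical all_reals all_analysis.
From mathcomp Require Import ring lra.

Set Implicit Arguments.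
Unset Strict Implicit.
Unset Printing Implicit Defensive.

Import Order.TTheory GRing.Theory Num.Theory.
Import numFieldNormedType.Exports.

Local Open Scope classical_set_scope.
Local Open Scope ring_scope.

(* With [B = b / sigma ^ 4], the logarithmic derivative [w = u' / u] satisfies
   the Riccati equation [w' = B - (N - 1) / r * w - w ^ 2], whose right-hand
   side is nondecreasing in [r] and decreasing in [w > 0].  Since
   [w 0 = 0 < w s], a comparison with the constant [w s] on [0, s] forces
   [w' s > 0], so the control magnitude [sigma ^ 2 * w] is strictly increasing;
   moreover [w <= r * B <= r ^ 3 / sigma ^ 4] and [w' <= B <= r ^ 2 / sigma ^ 4],
   which makes [h (|x|)] of class C^2 across the origin.  Uniqueness: the
   Hopf-Cole transform [exp (- z / (2 * sigma ^ 2))] turns the equation into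
   [Delta v = B (|x|) v] with [B >= 0], to which the weak maximum principle
   applies after adding [eps * |x| ^ 2]. *)

(** * Difference quotients and derivatives relative to an interval *)

Section DerivativeWithin.
Context {R : realType}.
Implicit Types (A : set R) (f g : R -> R) (r a c : R).

Lemma cvg_within_dnbhs A f r :
  {within A, continuous f} -> A r -> f @ within A r^' --> f r.
Proof.
move=> /subspace_continuousP cf Ar; apply: cvg_trans (cf r Ar).
by apply: (@cvg_app _ _ _ _ f) => B; exact: nbhs_dnbhs.
Qed.

Lemma cvg_within_derivable A f r : derivable_within A f r ->
  (fun s => (s - r)^-1 * (f s - f r)) @ within A r^' --> derive_within A f r.
Proof. by []. Qed.

(** Since [A] is a neighbourhood of [r], restricting punctured neighbourhoods of [r] to [A] changes
    no limit, and the difference quotient completed by its limit at [r] is a Caratheodory slope. *)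
Lemma is_derive_within A f r : nbhs r A -> derivable_within A f r ->
  is_derive r 1 f (derive_within A f r).
Proof.
move=> rA /cvg_within_derivable; set l := derive_within A f r => cl.
apply/is_derive1_caratheodory.
exists (fun s => if s == r then l else (s - r)^-1 * (f s - f r)); split.
- move=> z; case: eqP => [->|/eqP]; first by rewrite !subrr mulr0.
  by rewrite -subr_eq0 => zr; rewrite mulrAC mulVf// mul1r.
- apply/continuous_withinNx; rewrite eqxx.
  apply: cvg_trans cl.
  have E : \forall s \near r^', A s by apply: nbhs_dnbhs.
  apply: (@cvg_trans _ ((fun s => (s - r)^-1 * (f s - f r)) @ r^')).
    apply: near_eq_cvg; near=> s; rewrite ifN//.
    by near: s; rewrite near_withinE; near=> s.
  apply: cvg_app => B /= BA; near=> s; have : A s by near: s.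
  by near: s.
- by rewrite eqxx.
Unshelve. all: by end_near. Qed.

(** Factoring [g y - g (f r)] as [q y * (y - f r)], with [q] continuous at [f r], avoids a division
    by [f s - f r], which may vanish. *)
Lemma cvg_within_comp A f g r (dg df : R) :
  f @ within A r^' --> f r ->
  (fun s => (s - r)^-1 * (f s - f r)) @ within A r^' --> df ->
  is_derive (f r) 1 g dg ->
  (fun s => (s - r)^-1 * (g (f s) - g (f r))) @ within A r^' --> dg * df.
Proof.
move=> cf cdf /is_derive1_caratheodory[q [qE qc qr]].
have -> : (fun s => (s - r)^-1 * (g (f s) - g (f r))) =
  (fun s => q (f s) * ((s - r)^-1 * (f s - f r))).
  by apply/funext => s; rewrite qE mulrCA.
apply: cvgM cdf; rewrite -qr; exact: continuous_cvg.
Qed.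

(** Every point of a nondegenerate interval is an accumulation point of it. Limits along this filter
    are then unique, so the [lim] in [derive_within] can be evaluated. *)
Lemma itv_proper_within a b r : a < b -> r \in `[a, b] ->
  ProperFilter (within `[a, b]%classic r^').
Proof.
move=> ab; rewrite in_itv /= => /andP[ar rb].
apply: Build_ProperFilter_ex => P.
case/nbhs_ballP => e /= e0 H.
(* The witness lies to the right of [r] when there is room, and otherwise, at [r = b], to its
   left. *)
have [rb'|br] := ltP r b.
  pose s := r + Num.min (e / 2) (b - r).
  exists s; apply: H.
  - rewrite /ball /= /s opprD addNKr normrN gtr0_norm ?lt_min ?subr_gt0 ?divr_gt0//.
    by rewrite gt_min; lra.
  - by rewrite /s gt_eqF// ltrDl lt_min subr_gt0 rb' divr_gt0.
  - rewrite /= in_itv /= /s; apply/andP; split.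
      by rewrite (le_trans ar)// lerDl le_min subr_ge0 rb/= ltW// divr_gt0.
    by rewrite -lerBrDl ge_min lexx orbT.
pose s := r - Num.min (e / 2) (r - a).
have ar' : a < r by apply: lt_le_trans ab br.
exists s; apply: H.
- rewrite /ball /= /s opprB addrCA subrr addr0 gtr0_norm ?lt_min ?subr_gt0 ?divr_gt0//.
  by rewrite gt_min; lra.
- by rewrite /s lt_eqF// ltrBlDr ltrDl lt_min subr_gt0 ar' divr_gt0.
- rewrite /= in_itv /= /s; apply/andP; split.
    by rewrite lerBrDl -lerBrDr ge_min lexx orbT.
  by rewrite lerBlDr (le_trans rb)// lerDl le_min subr_ge0 ar/= ltW// divr_gt0.
Qed.

Lemma derivable_derive_within a b f r l : a < b -> r \in `[a, b] ->
  (fun s => (s - r)^-1 * (f s - f r)) @ within `[a, b]%classic r^' --> l ->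
  derivable_within `[a, b]%classic f r /\ derive_within `[a, b]%classic f r = l.
Proof.
move=> ab rab cl; have FF := itv_proper_within ab rab.
by split; [apply/cvg_ex; exists l | exact: cvg_lim].
Qed.

End DerivativeWithin.

(** * Monotonicity and convexity from the derivative, by the mean value theorem *)

Section Monotone.
Context {R : realType}.
Implicit Types (f df : R -> R) (a b : R).

Lemma is_derive_nondecreasing f df a b :
  (forall x, a < x < b -> is_derive x 1 f (df x)) ->
  (forall x, a < x < b -> 0 <= df x) ->
  {within `[a, b], continuous f} ->
  forall x y, a <= x -> x <= y -> y <= b -> f x <= f y.
Proof.
move=> fd df0 cf x y ax xy yb.
move: xy; rewrite le_eqVlt => /predU1P[->//|xy].
have [||z ] := @MVT R f df x y xy.
- move=> z; rewrite in_itv/= => /andP[xz zy]; apply: fd.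
  by rewrite (le_lt_trans ax xz) (lt_le_trans zy).
- apply: continuous_subspaceW cf; apply: subset_itv; by rewrite bnd_simp.
rewrite in_itv/= => /andP[xz zy] E; rewrite -subr_ge0 E; apply: mulr_ge0; last lra.
by apply: df0; rewrite (le_lt_trans ax xz) (lt_le_trans zy).
Qed.

Lemma is_derive_increasing f df a b :
  (forall x, a < x < b -> is_derive x 1 f (df x)) ->
  (forall x, a < x < b -> 0 < df x) ->
  {within `[a, b], continuous f} ->
  forall x y, a <= x -> x < y -> y <= b -> f x < f y.
Proof.
move=> fd df0 cf x y ax xy yb.
have [||z ] := @MVT R f df x y xy.
- move=> z; rewrite in_itv/= => /andP[xz zy]; apply: fd.
  by rewrite (le_lt_trans ax xz) (lt_le_trans zy).
- apply: continuous_subspaceW cf; apply: subset_itv; by rewrite bnd_simp.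
rewrite in_itv/= => /andP[xz zy] E; rewrite -subr_gt0 E; apply: mulr_gt0; last lra.
by apply: df0; rewrite (le_lt_trans ax xz) (lt_le_trans zy).
Qed.

(** The mean value theorem on either side of the intermediate point [m] gives slopes
    [df z1 <= df z2], and the convexity gap is [s * (1 - s) * (y1 - x1)] times their difference. *)
Lemma nondecreasing_derive_convex f df a b :
  (forall x, a < x < b -> is_derive x 1 f (df x)) ->
  (forall x y, a < x -> x <= y -> y < b -> df x <= df y) ->
  {within `[a, b], continuous f} ->
  convex_function (`[a, b]%classic : set R) f.
Proof.
move=> fd dfm cf t x y.
rewrite !inE /= !in_itv /= => /andP[ax xb] /andP[ay yb].
have K x1 y1 (s : R) : a <= x1 -> x1 < y1 -> y1 <= b -> 0 <= s -> s <= 1 ->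
    f (s * x1 + (1 - s) * y1) <= s * f x1 + (1 - s) * f y1.
  move=> ax1 xy1 yb1; rewrite le_eqVlt => /predU1P[<- _|s0].
    by rewrite !mul0r !add0r subr0 !mul1r.
  rewrite le_eqVlt => /predU1P[->|s1]; first by rewrite subrr !mul0r !addr0 !mul1r.
  set m := _ + _.
  have xm : x1 < m by rewrite /m; nra.
  have my : m < y1 by rewrite /m; nra.
  have [||z1 ] := @MVT R f df x1 m xm.
  - move=> z; rewrite in_itv/= => /andP[? ?]; apply: fd; lra.
  - apply: continuous_subspaceW cf; apply: subset_itv; rewrite bnd_simp; lra.
  rewrite in_itv/= => /andP[? ?] E1.
  have [||z2 ] := @MVT R f df m y1 my.
  - move=> z; rewrite in_itv/= => /andP[? ?]; apply: fd; lra.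
  - apply: continuous_subspaceW cf; apply: subset_itv; rewrite bnd_simp; lra.
  rewrite in_itv/= => /andP[? ?] E2.
  have D : df z1 <= df z2 by apply: dfm; lra.
  have M1 : m - x1 = (1 - s) * (y1 - x1) by rewrite /m; ring.
  have M2 : y1 - m = s * (y1 - x1) by rewrite /m; ring.
  rewrite M1 in E1; rewrite M2 in E2.
  have P : 0 <= s * (1 - s) * (y1 - x1) by rewrite !mulr_ge0//; lra.
  have := ler_wpM2l P D.
  rewrite -subr_ge0 => H; rewrite -subr_ge0; move: H.
  suff -> : s * f x1 + (1 - s) * f y1 - f m =
    s * (1 - s) * (y1 - x1) * df z2 - s * (1 - s) * (y1 - x1) * df z1 by [].
  have -> : f y1 = f m + df z2 * (s * (y1 - x1)) by rewrite -E2; ring.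
  have -> : f x1 = f m - df z1 * ((1 - s) * (y1 - x1)) by rewrite -E1; ring.
  ring.
have t0 : 0 <= t%:num by [].
have t1 : t%:num <= 1 by [].
rewrite /conv /= /GRing.scale /= /unstable.onem.
(* [K] takes ordered points; the reversed order exchanges the weights [t] and [1 - t]. *)
have [xy|yx|<-] := ltgtP x y.
- exact: K.
- have := @K y x (1 - t%:num) ay yx xb.
  rewrite (_ : 1 - (1 - t%:num) = t%:num); last by ring.
  move=> H; rewrite [X in f X]addrC [leRHS]addrC. by apply: H; lra.
- by rewrite -/(conv _ _ _) convmm -mulrDl subrKC mul1r.
Qed.

End Monotone.

(** * Calculus rules for directional derivatives *)

Section DirectionalDerivative.
Context {R : realType} {V : normedModType R}.
Implicit Types (f g : V -> R) (x v : V).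

(** This rule and the next three restate the usual ones with explicit lambda terms, the shape of the
    functions differentiated below. *)
Lemma is_derive_add f g x v (df dg : R) : is_derive x v f df ->
  is_derive x v g dg -> is_derive x v (fun y => f y + g y) (df + dg).
Proof. exact: is_deriveD. Qed.

Lemma is_derive_sub f g x v (df dg : R) : is_derive x v f df ->
  is_derive x v g dg -> is_derive x v (fun y => f y - g y) (df - dg).
Proof. exact: is_deriveB. Qed.

Lemma is_derive_mul f g x v (df dg : R) : is_derive x v f df ->
  is_derive x v g dg -> is_derive x v (fun y => f y * g y) (f x * dg + g x * df).
Proof. exact: is_deriveM. Qed.

Lemma is_derive_scale (c : R) f x v (df : R) : is_derive x v f df ->
  is_derive x v (fun y => c * f y) (c * df).
Proof. exact: is_deriveZ. Qed.

(** A directional derivative does not make [f] continuous at [x], but the restriction of [f] to the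
    line through [x] is differentiable at [0], hence continuous there. *)
Lemma derivable_line_continuous f x v : derivable f x v ->
  (fun h : R => f (h *: v + x)) @ 0^' --> f x.
Proof.
move=> df.
suff : {for 0, continuous (fun h : R => f(h *: v + x))}.
  by move=> /continuous_withinNx; rewrite scale0r add0r.
exact/differentiable_continuous/derivable1_diffP/(derivable1P _ _ _).1.
Qed.

(** Continuity of [f] along the line suffices, because the Caratheodory slope [q] of [g] is
    evaluated only at the points [f (h *: v + x)]. *)
Lemma is_derive_comp (g : R -> R) f x v (df dg : R) :
  is_derive (f x) 1 g dg -> is_derive x v f df ->
  is_derive x v (fun y => g (f y)) (dg * df).
Proof.
move=> /is_derive1_caratheodory[q [qE qc qr]] [df1 df2].
suff H : (fun h : R => h^-1 *: (((fun y => g (f y)) \o shift x) (h *: v)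
    - g (f x))) @ 0^' --> dg * df.
  by apply: DeriveDef; [apply/cvg_ex; exists (dg * df)|exact: cvg_lim].
have -> : (fun h : R => h^-1 *: (((fun y => g (f y)) \o shift x) (h *: v)
    - g (f x))) = (fun h => q (f (h *: v + x)) *
      (h^-1 *: ((f \o shift x) (h *: v) - f x))).
  by apply/funext => h /=; rewrite qE /GRing.scale /= mulrCA.
apply: cvgM; last by rewrite -df2; exact: df1.
rewrite -qr; apply: continuous_cvg => //.
exact: derivable_line_continuous.
Qed.

End DirectionalDerivative.

(** * The radial equation and the Riccati equation of its logarithmic derivative *)

Section RadialODE.
Context {R : realType}.
Variables (m : nat) (rho C : R) (B u u1 : R -> R).
Hypothesis rho_gt0 : 0 < rho.
Hypothesis u_gt0 : forall r, 0 <= r <= rho -> 0 < u r.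
Hypothesis cu : {within `[0, rho], continuous u}.
Hypothesis cu1 : {within `[0, rho], continuous u1}.
Hypothesis du : forall r, 0 < r < rho -> is_derive r 1 u (u1 r).
Hypothesis du1 : forall r, 0 < r < rho ->
  is_derive r 1 u1 (B r * u r - m%:R / r * u1 r).
Hypothesis u10 : u1 0 = 0.
Hypothesis B_gt0 : forall r, 0 < r -> 0 < B r.
Hypothesis B_nondecr : forall r s, 0 <= r -> r <= s -> B r <= B s.
Hypothesis B_le : forall r, 0 < r -> B r <= C * r ^+ 2.

Let w r := u1 r / u r.
Let phi r := B r - m%:R / r * w r - w r ^+ 2.

Let cont_within (f : R -> R) s : s <= rho ->
  (forall r, 0 <= r <= s -> f @ within `[0, rho]%classic (nbhs r) --> f r) ->
  {within `[0, s], continuous f}.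
Proof.
move=> srho H; apply/subspace_continuousP => r /=; rewrite in_itv/= => rs.
apply: cvg_trans (H r rs); apply: cvg_app => P; apply: within_subset.
by apply: subset_itv; rewrite bnd_simp.
Qed.

Let cvg_u r : 0 <= r <= rho -> u @ within `[0, rho]%classic (nbhs r) --> u r.
Proof.
by move=> rr; have /subspace_continuousP := cu; apply; rewrite /= in_itv.
Qed.

Let cvg_u1 r : 0 <= r <= rho -> u1 @ within `[0, rho]%classic (nbhs r) --> u1 r.
Proof.
by move=> rr; have /subspace_continuousP := cu1; apply; rewrite /= in_itv.
Qed.

Let cvg_cont (f : R -> R) r : continuous f ->
  f @ within `[0, rho]%classic (nbhs r) --> f r.
Proof. by move=> cf; apply: cvg_within_filter; exact: cf. Qed.

(* [r ^ m * u1 r] has the positive derivative [r ^ m * B r * u r]. *)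
Lemma radial_derive_gt0 r : 0 < r <= rho -> 0 < u1 r.
Proof.
move=> /andP[r0 rr].
suff : 0 ^+ m * u1 0 < r ^+ m * u1 r by rewrite u10 mulr0 pmulr_rgt0// exprn_gt0.
apply: (@is_derive_increasing R (fun r => r ^+ m * u1 r)
  (fun r => r ^+ m * (B r * u r)) 0 rho _ _ _ 0 r (lexx _) r0 rr).
- move=> t /andP[t0 tr].
  have D : is_derive t 1 (fun t : R => t ^+ m) (m%:R * t ^+ m.-1).
    apply: DeriveDef; first exact: exprn_derivable.
    by rewrite exp_derive /GRing.scale /= mulr1.
  apply: is_derive_eq (is_derive_mul D (du1 _)) _; first by rewrite t0.
  (* The case [m = 0] is treated apart because [m.-1] is then [0], not [-1]. *)
  case: (m) => [|k] /=; first by field; lra.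
  by rewrite exprS; field; lra.
- move=> t /andP[t0 tr]; rewrite !mulr_gt0 ?exprn_gt0// ?B_gt0// ?u_gt0//.
  by rewrite !ltW.
- apply: cont_within => // t tr; apply: cvgM; last exact: cvg_u1.
  by apply: (cvg_cont (f := fun t => t ^+ m)); exact: exprn_continuous.
Qed.

Lemma radial_logderive_gt0 r : 0 < r <= rho -> 0 < w r.
Proof.
move=> /[dup] rr /radial_derive_gt0 ?; apply: divr_gt0 => //; apply: u_gt0.
by move: rr => /andP[/ltW -> ->].
Qed.

Lemma radial_logderive0 : w 0 = 0.
Proof. by rewrite /w u10 mul0r. Qed.

(* If [phi s <= 0] then [expR (k t) * (c * u t - u1 t)], with [c := w s] and
   [k := m / s + c], is nondecreasing on [[0, s]], although it is positive at
   [0] and vanishes at [s]. *)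
Lemma radial_riccati_gt0 s : 0 < s <= rho -> 0 < phi s.
Proof.
move=> /[dup] sr /andP[s0 srho]; rewrite ltNge; apply/negP => phis.
have c0 := radial_logderive_gt0 sr.
pose c := w s; pose k := m%:R / s + c.
have ms0 : 0 <= m%:R / s by rewrite divr_ge0 // ltW.
(* Since [phi s] equals [B s - k * c], the assumption on [phi s] is exactly this bound. *)
have kcB : B s <= k * c.
  rewrite -subr_le0; apply: le_trans phis; rewrite /phi -/c /k.
  by rewrite (_ : B s - _ = B s - m%:R / s * c - c ^+ 2); [|ring].
pose F t := expR (k * t) * (c * u t - u1 t).
suff : F 0 <= F s.
  rewrite /F mulr0 expR0 mul1r u10 subr0.
  rewrite [c * u s](_ : _ = u1 s) ?subrr ?mulr0.
    by rewrite leNgt mulr_gt0// u_gt0// lexx ltW.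
  by rewrite /c /w divfK// gt_eqF// u_gt0// ltW.
(* As [k - c = m / s], the derivative of [F] splits into two terms that are nonnegative for [t < s]:
   the first because [B t <= B s <= k * c], the second because [u1 t > 0] and [t^-1 > s^-1]. *)
apply: (@is_derive_nondecreasing R F
  (fun t => expR (k * t) * ((k * c - B t) * u t + m%:R * u1 t * (t^-1 - s^-1)))
  0 s _ _ _ 0 s (lexx _) (ltW s0) (lexx _)).
- move=> t /andP[t0 ts]; have tr : 0 < t < rho by rewrite t0 (lt_le_trans ts).
  have D1 : is_derive t 1 (fun t : R => expR (k * t)) (expR (k * t) * (k * 1)).
    exact: (is_derive_comp (is_derive_expR _) (is_derive_scale k (is_derive_id t 1))).
  have D2 := is_derive_sub (is_derive_scale c (du tr)) (du1 tr).
  apply: is_derive_eq (is_derive_mul D1 D2) _ => /=.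
  by rewrite /k; field; lra.
- move=> t /andP[t0 ts]; have tr : 0 < t <= rho by rewrite t0 ltW// (lt_le_trans ts).
  rewrite mulr_ge0 ?expR_ge0// addr_ge0//.
    apply: mulr_ge0; last by rewrite ltW// u_gt0// ltW//; case/andP: tr.
    by rewrite subr_ge0 (le_trans _ kcB)// B_nondecr// ltW.
  rewrite mulr_ge0 ?mulr_ge0// ?ltW// ?radial_derive_gt0//.
  by rewrite subr_gt0 ltf_pV2.
- apply: cont_within => // t /andP[t0 ts].
  have tr : 0 <= t <= rho by rewrite t0 (le_trans ts).
  apply: cvgM.
    apply: (cvg_cont (f := fun t => expR (k * t))) => y.
    apply: continuous_comp; last exact: continuous_expR.
    exact: mulrl_continuous.
  by apply: cvgB; [apply: cvgM; [exact: cvg_cst|exact: cvg_u]|exact: cvg_u1].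
Qed.

Lemma is_derive_logderive r : 0 < r < rho -> is_derive r 1 w (phi r).
Proof.
move=> /[dup] rr /andP[r0 rrho].
have u0 : 0 < u r by apply: u_gt0; rewrite !ltW.
have D : is_derive r 1 (fun t => (u t)^-1) (- (u r) ^- 2 * u1 r).
  by apply: is_deriveV; [rewrite gt_eqF|exact: du].
apply: is_derive_eq (is_derive_mul (du1 rr) D) _.
by rewrite /phi /w; field; rewrite !gt_eqF.
Qed.

Lemma radial_logderive_continuous : {within `[0, rho], continuous w}.
Proof.
apply: cont_within => // r rr; apply: cvgM; first exact: cvg_u1.
by apply: cvgV; [rewrite gt_eqF// u_gt0|exact: cvg_u].
Qed.

Lemma radial_logderive_increasing r s :
  0 <= r -> r < s -> s <= rho -> w r < w s.
Proof.
apply: (@is_derive_increasing R w phi) => //.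
- exact: is_derive_logderive.
- by move=> t /andP[t0 tr]; rewrite radial_riccati_gt0// t0 ltW.
- exact: radial_logderive_continuous.
Qed.

Lemma radial_riccati_le r : 0 < r <= rho -> phi r <= B r.
Proof.
move=> /[dup] rr /andP[r0 rrho]; rewrite /phi -addrA gerDl -opprD oppr_le0.
have w0 := ltW (radial_logderive_gt0 rr).
by rewrite addr_ge0 ?sqr_ge0// mulr_ge0// divr_ge0// ltW.
Qed.

(** On [[0, r]] the derivative of [w] is at most [B t <= B r], so [B r * t - w t] is nondecreasing
    in [t] and starts at [0]. Hence [w r <= r * B r], and [B_le] concludes. *)
Lemma radial_logderive_le r : 0 < r <= rho -> w r <= C * r ^+ 3.
Proof.
move=> /andP[r0 rr]; rewrite exprS mulrCA.
suff : 0 <= r * B r - w r.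
  by rewrite subr_ge0 => /le_trans; apply; rewrite ler_pM2l// B_le.
suff : B r * 0 - w 0 <= B r * r - w r.
  by rewrite mulr0 radial_logderive0 subrr mulrC.
apply: (@is_derive_nondecreasing R (fun t => B r * t - w t)
  (fun t => B r * 1 - phi t) 0 r _ _ _ 0 r (lexx _) (ltW r0) (lexx _)).
- move=> t /andP[t0 ts]; have tr : 0 < t < rho by rewrite t0 (lt_le_trans ts).
  exact: (is_derive_sub (is_derive_scale (B r) (is_derive_id t 1))
    (is_derive_logderive tr)).
- move=> t /andP[t0 ts]; rewrite mulr1 subr_ge0.
  apply: le_trans (radial_riccati_le _) _; first by rewrite t0 ltW// (lt_le_trans ts).
  by rewrite B_nondecr// ltW.
- apply: cont_within => // t /andP[t0 tr].
  have trho : 0 <= t <= rho by rewrite t0 (le_trans tr).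
  apply: cvgB; first by apply: (cvg_cont (f := fun t => B r * t)); exact: mulrl_continuous.
  by have /subspace_continuousP := radial_logderive_continuous; apply; rewrite /= in_itv.
Qed.

(** In the equation the term [- m / r * u1 r] is nonpositive, so the sign of the second derivative
    of [u] is not evident. Written as [u r * (phi r + w r ^+ 2)], it is positive by
    [radial_riccati_gt0]. *)
Lemma radial_convex : convex_function (`[0, rho]%classic : set R) u.
Proof.
apply: (@nondecreasing_derive_convex R u u1) => //.
move=> x y x0 xy yr.
apply: (@is_derive_nondecreasing R u1 _ 0 rho du1) => //; try lra.
move=> r /[dup] rr /andP[r0 rrho].
have ur : 0 < u r by apply: u_gt0; rewrite !ltW.
rewrite (_ : _ - _ = u r * (phi r + w r ^+ 2)).
  rewrite mulr_ge0 ?(ltW ur)// addr_ge0 ?sqr_ge0//.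
  by apply/ltW/radial_riccati_gt0; rewrite r0 ltW.
by rewrite /phi /w; field; rewrite !gt_eqF.
Qed.

End RadialODE.

(** * The Euclidean norm: topology and partial derivatives *)

Section EuclideanNorm.
Context {R : realType} {N : nat}.
Implicit Types (x y p q : 'rV[R]_N) (c : R).

Lemma dotxx_ge0 x : 0 <= dot x x.
Proof. by apply: sumr_ge0 => i _; rewrite -expr2 sqr_ge0. Qed.

Lemma enorm_ge0 x : 0 <= enorm x.
Proof. exact: sqrtr_ge0. Qed.

Lemma enorm_sqr x : enorm x ^+ 2 = dot x x.
Proof. by rewrite sqr_sqrtr ?dotxx_ge0. Qed.

Lemma dotC p q : dot p q = dot q p.
Proof. by apply: eq_bigr => i _; rewrite mulrC. Qed.

Lemma dotDl x p q : dot (p + q) x = dot p x + dot q x.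
Proof. by rewrite -big_split; apply: eq_bigr => i _; rewrite mxE mulrDl. Qed.

Lemma dotZl c p q : dot (c *: p) q = c * dot p q.
Proof. by rewrite mulr_sumr; apply: eq_bigr => i _; rewrite mxE mulrA. Qed.

Lemma coord_le_enorm x (i : 'I_N) : `|x ord0 i| <= enorm x.
Proof.
rewrite -(ger0_norm (enorm_ge0 x)) -ler_sqr ?nnegrE// !real_normK ?num_real//.
rewrite enorm_sqr /dot (bigD1 i)//= -expr2 lerDl.
by apply: sumr_ge0 => j _; rewrite -expr2 sqr_ge0.
Qed.

Lemma enorm0 : enorm (0 : 'rV[R]_N) = 0.
Proof.
rewrite /enorm /dot big1 ?sqrtr0// => i _; by rewrite mxE mul0r.
Qed.

Lemma enorm_eq0 x : (enorm x == 0) = (x == 0).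
Proof.
apply/eqP/eqP => [x0|->]; last exact: enorm0.
apply/rowP => i; rewrite mxE; apply/eqP; rewrite -normr_le0 -x0.
exact: coord_le_enorm.
Qed.

Lemma enorm_gt0 x : (0 < enorm x) = (x != 0).
Proof. by rewrite lt_neqAle eq_sym enorm_eq0 enorm_ge0 andbT. Qed.

Lemma enormZ c x : enorm (c *: x) = `|c| * enorm x.
Proof.
by rewrite /enorm dotZl dotC dotZl mulrA -expr2 sqrtrM ?sqr_ge0// sqrtr_sqr.
Qed.

Lemma enorm_delta (i : 'I_N) : enorm (delta_mx ord0 i : 'rV[R]_N) = 1.
Proof.
rewrite /enorm /dot (bigD1 i)//= big1 => [|j ji]; rewrite !mxE eqxx/=.
  by rewrite eqxx mulr1 addr0 sqrtr1.
by rewrite (negPf ji) mul0r.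
Qed.

Lemma enorm_continuous : continuous (enorm : 'rV[R]_N -> R).
Proof.
move=> x; apply: continuous_comp; last exact: sqrt_continuous.
have cc (i : 'I_N) : continuous (fun y : 'rV[R]_N => y ord0 i).
  exact: coord_continuous.
have cm (i : 'I_N) : continuous (fun y : 'rV[R]_N => y ord0 i * y ord0 i).
  by move=> y; exact: (continuousM (cc i y) (cc i y)).
apply: (@continuous_big _ _ _ _ _ _ _ _ (fun i (y : 'rV[R]_N) => y ord0 i * y ord0 i)).
  exact: add_continuous.
by move=> i _; exact: cm.
Qed.

Lemma open_enorm_lt c : open [set x : 'rV[R]_N | enorm x < c].
Proof.
apply: (@open_comp _ _ enorm [set r | r < c]); last exact: open_lt.
by move=> x _; exact: enorm_continuous.
Qed.

(** Boundedness refers to the sup norm, which is at most [enorm] by [coord_le_enorm]; closedness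
    comes from continuity of [enorm]. *)
Lemma compact_enorm_le c : compact [set x : 'rV[R]_N | enorm x <= c].
Proof.
apply: bounded_closed_compact.
  exists c; split; first exact: num_real.
  move=> d cd x /= xc; rewrite /Num.norm /= mx_normrE.
  apply: bigmax_le => [|[i j] _ /=].
    by rewrite (le_trans _ (ltW cd))// (le_trans _ xc)// enorm_ge0.
  rewrite (ord1 i); apply: le_trans (ltW cd); apply: le_trans xc.
  exact: coord_le_enorm.
apply: (@preimage_closed _ _ enorm [set r | r <= c]); last exact: closed_le.
by move=> x _; exact: enorm_continuous.
Qed.

Lemma is_derive_coord (i : 'I_N) x v :
  is_derive x v (fun y => y ord0 i) (v ord0 i).
Proof.
have E : (fun h : R => h^-1 *: (((fun y : 'rV[R]_N => y ord0 i) \o shift x) (h *: v)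
   - x ord0 i)) @ 0^' --> v ord0 i.
  apply: cvg_near_cst; near=> h.
  rewrite /= !mxE addrK /GRing.scale /= mulKf//.
  by near: h; exact: nbhs_dnbhs_neq.
by split; [apply/cvg_ex; eexists; exact: E|exact: cvg_lim].
Unshelve. all: by end_near. Qed.

Lemma is_derive_dotxx (i : 'I_N) x :
  is_derive x (delta_mx ord0 i) (fun y => dot y y) (2 * x ord0 i).
Proof.
rewrite (_ : (fun y => dot y y) =
  \sum_(j < N) ((fun y : 'rV[R]_N => y ord0 j * y ord0 j) : 'rV[R]_N -> R)).
  apply: is_derive_eq (is_derive_sum (fun j =>
    is_derive_mul (is_derive_coord j _ _) (is_derive_coord j _ _))) _.
  rewrite (bigD1 i)//= big1 => [|j ji]; rewrite !mxE eqxx/=.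
    by rewrite eqxx !mulr1 addr0 mulr_natl mulr2n.
  by rewrite (negPf ji) mulr0 addr0.
by apply/funext => y; rewrite fct_sumE.
Qed.

Lemma is_derive_enorm (i : 'I_N) x : x != 0 ->
  is_derive x (delta_mx ord0 i) enorm (x ord0 i / enorm x).
Proof.
move=> x0; have n0 : 0 < dot x x by rewrite -enorm_sqr exprn_gt0// enorm_gt0.
have D := is_derive_comp (f := fun y => dot y y) (is_derive1_sqrt n0)
  (is_derive_dotxx i x).
apply: (@is_derive_eq _ _ _ _ _ _ _ _ D).
by rewrite -/(enorm x) invfM mulrAC mulrA mulVf ?mul1r// mulrC.
Qed.

End EuclideanNorm.

(** * Differentiability and continuity at a point from growth bounds *)

Section Flat.
Context {R : realType}.

(** Stands in for the chain rule at the origin, where [enorm] is not differentiable: a quadratic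
    bound on the increments makes the difference quotients tend to [0]. *)
Lemma is_derive_flat (V : normedModType R) (f : V -> R) (x v : V) (c : R) :
  (\forall h \near (0 : R), `|f (h *: v + x) - f x| <= c * h ^+ 2) ->
  is_derive x v f 0.
Proof.
move=> H.
have E : (fun h : R => h^-1 *: ((f \o shift x) (h *: v) - f x)) @ 0^' --> (0 : R).
  apply/cvgr0Pnorm_le => e e0; near=> h.
  have h0 : h != 0 by near: h; exact: nbhs_dnbhs_neq.
  rewrite /GRing.scale /= normrM normfV mulrC ler_pdivrMr ?normr_gt0//.
  have : `|f (h *: v + x) - f x| <= c * h ^+ 2 by near: h; exact: nbhs_dnbhs.
  move=> /le_trans; apply.
  rewrite -(@real_normK _ h) ?num_real// expr2 mulrA ler_pM2r ?normr_gt0//.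
  (* The sign of [c] is not known; its absolute value plus one is a positive denominator. *)
  have hc : `|h| <= e / (`|c| + 1).
    by near: h; apply: dnbhs0_le; rewrite divr_gt0// ltr_wpDl.
  rewrite ler_pdivlMr ?ltr_wpDl// in hc.
  apply: le_trans hc; rewrite mulrC ler_wpM2l//.
  by rewrite (le_trans (ler_norm c))// lerDl.
by split; [apply/cvg_ex; exists 0; exact: E|exact: cvg_lim].
Unshelve. all: by end_near. Qed.

(** Serves at the origin, where the formulas for the derivatives of a radial function divide by the
    radius and cannot be treated by composition. *)
Lemma enorm_bound_continuous (N : nat) (f : 'rV[R]_N -> R) (c rho : R) : 0 < rho ->
  (forall y, enorm y < rho -> `|f y - f 0| <= c * enorm y) ->
  {for 0, continuous f}.
Proof.
move=> r0 H; suff : f @ nbhs (0 : 'rV[R]_N) --> f 0 by [].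
apply/cvgrPdistC_le => e e0; near=> y.
have yr : enorm y < rho.
  near: y; have := @open_enorm_lt R N rho; rewrite openE => /(_ 0); apply.
  by rewrite /= enorm0.
have yc : enorm y < e / (`|c| + 1).
  near: y; have := @open_enorm_lt R N (e / (`|c| + 1)); rewrite openE => /(_ 0); apply.
  by rewrite /= enorm0 divr_gt0// ltr_wpDl.
apply: le_trans (H _ yr) _.
rewrite ltr_pdivlMr ?ltr_wpDl// in yc.
apply: le_trans (ltW yc); rewrite mulrC ler_wpM2l ?enorm_ge0//.
by rewrite (le_trans (ler_norm c))// lerDl.
Unshelve. all: by end_near. Qed.

Lemma near_eq_continuous (T U : topologicalType) (f g : T -> U) x :
  {near x, f =1 g} -> {for x, continuous g} -> {for x, continuous f}.
Proof.
move=> fg cg; have fgx : f x = g x := nbhs_singleton fg.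
suff : f @ nbhs x --> g x by rewrite -fgx.
apply: cvg_trans cg; apply: near_eq_cvg.
by apply: filterS fg => y ->.
Qed.

End Flat.

(** * Radial functions of several variables: gradient, Hessian and C^2 regularity *)

Section RadialFunction.
Context {R : realType} {N : nat}.
Variables (rho C : R) (h h1 h2 : R -> R).
Hypothesis rho_gt0 : 0 < rho.
Hypothesis C_ge0 : 0 <= C.
Hypothesis dh : forall r, 0 < r < rho -> is_derive r 1 h (h1 r).
Hypothesis dh1 : forall r, 0 < r < rho -> is_derive r 1 h1 (h2 r).
Hypothesis ch : {within `[0, rho], continuous h}.
Hypothesis ch2 : forall r, 0 < r < rho -> {for r, continuous h2}.
Hypothesis h1_le : forall r, 0 < r < rho -> `|h1 r| <= C * r ^+ 3.
Hypothesis h2_le : forall r, 0 < r < rho -> `|h2 r| <= C * r ^+ 2.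

Let z (x : 'rV[R]_N) := h (enorm x).
(** The gradient of [z] is [k] times [x], and its Hessian has the entries
    [l * x_i * x_j + k * delta_ij]. Division by [0] yields [0], so both formulas vanish at the
    origin, which is the true value thanks to the growth bounds on [h1] and [h2]. *)
Let k r := h1 r / r.
Let l r := (h2 r - k r) / r ^+ 2.
Let dz i (x : 'rV[R]_N) := k (enorm x) * x ord0 i.
Let d2z i j (x : 'rV[R]_N) :=
  l (enorm x) * (x ord0 i * x ord0 j) + k (enorm x) * (i == j)%:R.

(** By the mean value theorem the increment is at most [C * s ^+ 3 * r] with [s < r]. Two factors
    [s] are bounded by [rho] and the third by [r], which leaves the quadratic form required by
    [is_derive_flat]. *)
Let h_le r : 0 <= r < rho -> `|h r - h 0| <= C * rho ^+ 2 * r ^+ 2.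
Proof.
rewrite le_eqVlt => /andP[/predU1P[<-|r0] rr].
  by rewrite subrr normr0 expr0n mulr0.
have [||s] := @MVT R h h1 0 r r0.
- move=> s; rewrite in_itv/= => /andP[s0 sr]; apply: dh.
  by rewrite s0 (lt_trans sr).
- apply: continuous_subspaceW ch; apply: subset_itv; rewrite bnd_simp//.
  exact: ltW.
rewrite in_itv/= subr0 => /andP[s0 sr] ->; rewrite normrM (gtr0_norm r0).
rewrite [r ^+ 2]expr2 mulrA ler_pM2r//.
have srho := lt_trans sr rr.
apply: le_trans (h1_le _) _; first by rewrite s0.
rewrite -mulrA ler_wpM2l// exprSr ler_pM ?sqr_ge0 ?(ltW s0) ?(ltW sr)//.
by rewrite lerXn2r ?nnegrE ?(ltW rho_gt0) ?(ltW s0) ?(ltW srho).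
Qed.

Let k_le r : 0 <= r < rho -> `|k r| <= C * r ^+ 2.
Proof.
rewrite le_eqVlt => /andP[/predU1P[<-|r0] rr].
  by rewrite /k invr0 mulr0 normr0 expr0n mulr0.
rewrite /k normrM normfV (gtr0_norm r0) ler_pdivrMr// -mulrA -exprSr.
by apply: h1_le; rewrite r0.
Qed.

Let l_le r : 0 <= r < rho -> `|l r * r ^+ 2| <= 2 * C * r ^+ 2.
Proof.
rewrite le_eqVlt => /andP[/predU1P[<-|r0] rr].
  by rewrite expr0n mulr0 mulr0 normr0.
rewrite /l divfK ?expf_eq0 ?gt_eqF//.
apply: le_trans (ler_normB _ _) _.
rewrite -mulrA mulr_natl mulr2n lerD ?k_le ?h2_le// ?r0// rr andbT ltW//.
Qed.

Lemma radial_continuous_within :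
  {within [set x : 'rV[R]_N | enorm x <= rho], continuous z}.
Proof.
apply/subspace_continuousP => x /= xr.
have /subspace_continuousP/(_ (enorm x)) := ch.
rewrite /= in_itv /= enorm_ge0 xr => /(_ isT) H.
apply: (@cvg_comp _ _ _ (enorm : 'rV[R]_N -> R) h _ _ _ _ H).
move=> P; rewrite /within /= => HP.
have HP' : \forall y \near x, enorm y \in `[0, rho] -> P (enorm y).
  exact: (@enorm_continuous R N x _ HP).
rewrite !nbhs_simpl /=; apply: filterS HP' => y + yr; apply.
by rewrite in_itv /= enorm_ge0 yr.
Qed.

Let open_ball : open [set x : 'rV[R]_N | enorm x < rho].
Proof. exact: open_enorm_lt. Qed.

Let near_ball (x : 'rV[R]_N) : enorm x < rho -> \forall y \near x, enorm y < rho.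
Proof. by move=> xr; have := open_ball; rewrite openE; apply. Qed.

Lemma radial_continuous (x : 'rV[R]_N) : enorm x < rho -> {for x, continuous z}.
Proof.
move=> xr; suff : z @ nbhs x --> z x by [].
have /subspace_continuousP/(_ x (ltW xr)) := radial_continuous_within.
rewrite within_interior//.
by apply: filterS (near_ball xr) => y /ltW.
Qed.

Let near_line (v : 'rV[R]_N) : enorm v = 1 ->
  \forall t \near (0 : R), enorm (t *: v) < rho.
Proof.
move=> v1; apply/nbhs_ballP; exists rho => //= t.
by rewrite /ball /= sub0r normrN enormZ v1 mulr1.
Qed.

(** Away from the origin this is the chain rule; at the origin [z] is flat by [h_le]. *)
Lemma is_derive_radial (i : 'I_N) x : enorm x < rho ->
  is_derive x (delta_mx ord0 i) z (dz i x).
Proof.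
move=> xr; have [->|x0] := eqVneq x 0.
  rewrite /dz mxE mulr0; apply: (@is_derive_flat _ _ _ _ _ (C * rho ^+ 2)).
  apply: filterS (near_line (enorm_delta i)) => t tr.
  rewrite addr0 /z enorm0; apply: le_trans (h_le _) _.
    by rewrite enorm_ge0.
  by rewrite enormZ enorm_delta mulr1 real_normK ?num_real.
have r0 : 0 < enorm x by rewrite enorm_gt0.
have D := is_derive_comp (f := enorm) (dh (introT andP (conj r0 xr)))
  (is_derive_enorm i x0).
by apply: is_derive_eq D _; rewrite /dz /k mulrA mulrAC.
Qed.

Lemma partial_radial (i : 'I_N) x : enorm x < rho -> partial i z x = dz i x.
Proof.
move=> xr; have D := is_derive_radial i xr.
exact: (@derive_val _ _ _ _ _ _ _ D).
Qed.

Let near_partial_radial (i : 'I_N) x : enorm x < rho ->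
  {near x, partial i z =1 dz i}.
Proof. by move=> /near_ball; apply: filterS => y /(partial_radial i). Qed.

Let is_derive_k r : 0 < r < rho ->
  is_derive r 1 k ((h2 r - k r) / r).
Proof.
move=> /[dup] rr /andP[r0 _].
have V : is_derive r 1 (fun t : R => t^-1) (- r ^- 2 * 1).
  by apply: (@is_deriveV _ id); rewrite gt_eqF.
apply: is_derive_eq (is_derive_mul (dh1 rr) V) _.
by rewrite /k; field; rewrite gt_eqF.
Qed.

Lemma is_derive_partial_radial (i j : 'I_N) x : enorm x < rho ->
  is_derive x (delta_mx ord0 j) (partial i z) (d2z i j x).
Proof.
move=> xr; apply: (@near_eq_is_derive _ _ _ (dz i)).
  by apply: filterS (near_partial_radial i xr) => y.
have [->|x0] := eqVneq x 0.
  have -> : d2z i j 0 = 0.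
    by rewrite /d2z !mxE !mulr0 enorm0 /k invr0 mulr0 mul0r addr0.
  apply: (@is_derive_flat _ _ _ _ _ (C * rho)).
  apply: filterS (near_line (enorm_delta j)) => t tr.
  rewrite addr0 {2}/dz mxE mulr0 subr0 /dz normrM.
  have tr' : enorm (t *: delta_mx ord0 j : 'rV[R]_N) = `|t|.
    by rewrite enormZ enorm_delta mulr1.
  rewrite tr' in tr *.
  (* The bound is cubic in [t]; one factor is absorbed into [rho] to make it quadratic. *)
  apply: (@le_trans _ _ (C * `|t| ^+ 2 * `|t|)).
    rewrite ler_pM// ?k_le// ?normr_ge0//.
    by rewrite -tr' coord_le_enorm.
  rewrite mulrAC real_normK ?num_real// ler_wpM2r ?sqr_ge0// ler_wpM2l//.
  exact: ltW.
have r0 : 0 < enorm x by rewrite enorm_gt0.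
have D := is_derive_comp (f := enorm) (is_derive_k (introT andP (conj r0 xr)))
  (is_derive_enorm j x0).
apply: is_derive_eq (is_derive_mul D (is_derive_coord i _ _)) _.
rewrite /d2z /l mxE eqxx /= addrC; congr (_ + _).
by field; rewrite gt_eqF.
Qed.

Lemma partial2_radial (i j : 'I_N) x : enorm x < rho ->
  partial j (partial i z) x = d2z i j x.
Proof.
move=> xr; have D := is_derive_partial_radial i j xr.
exact: (@derive_val _ _ _ _ _ _ _ D).
Qed.

Let continuous_enorm_comp (f : R -> R) (x : 'rV[R]_N) :
  {for enorm x, continuous f} -> {for x, continuous (fun y => f (enorm y))}.
Proof.
move=> cf; apply: (@continuous_comp _ _ _ (enorm : 'rV[R]_N -> R) f) => //.
exact: enorm_continuous.
Qed.

Let continuous_coord (i : 'I_N) : continuous (fun y : 'rV[R]_N => y ord0 i).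
Proof. exact: coord_continuous. Qed.

Let continuous_k r : 0 < r < rho -> {for r, continuous k}.
Proof.
move=> /is_derive_k[D _].
exact/differentiable_continuous/derivable1_diffP.
Qed.

Let continuous_dz (i : 'I_N) x : enorm x < rho -> {for x, continuous (dz i)}.
Proof.
move=> xr; have [->|x0] := eqVneq x 0.
  apply: (@enorm_bound_continuous _ _ _ (C * rho ^+ 2) rho) => // y yr.
  rewrite {2}/dz mxE mulr0 subr0 /dz normrM.
  apply: ler_pM => //; last exact: coord_le_enorm.
  apply: le_trans (k_le _) _; first by rewrite enorm_ge0.
  by rewrite ler_wpM2l// lerXn2r ?nnegrE ?enorm_ge0 ?ltW.
apply: (continuousM (s := fun y => k (enorm y)) _ (@continuous_coord i x)).
by apply/continuous_enorm_comp/continuous_k; rewrite enorm_gt0 x0.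
Qed.

(** At the origin the two summands are at most [2 * C * r ^+ 2] and [C * r ^+ 2], where [r] is the
    norm, and one factor [r] is traded for [rho]. Elsewhere [h2] and [k] are continuous. *)
Let continuous_d2z (i j : 'I_N) x :
  enorm x < rho -> {for x, continuous (d2z i j)}.
Proof.
move=> xr; have [->|x0] := eqVneq x 0.
  apply: (@enorm_bound_continuous _ _ _ (3 * C * rho) rho) => // y yr.
  have -> : d2z i j 0 = 0.
    by rewrite /d2z !mxE !mulr0 enorm0 /k invr0 mulr0 mul0r addr0.
  have y0 := enorm_ge0 y.
  have yrr : 0 <= enorm y < rho by rewrite y0.
  rewrite subr0 (@le_trans _ _ (3 * C * enorm y ^+ 2))//; last first.
    rewrite expr2 mulrA ler_wpM2r// ler_wpM2l ?mulr_ge0//.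
    exact: ltW.
  apply: le_trans (ler_normD _ _) _.
  have -> : 3 * C * enorm y ^+ 2 = 2 * C * enorm y ^+ 2 + C * enorm y ^+ 2.
    by ring.
  apply: lerD.
    apply: le_trans (l_le yrr); rewrite normrM [leRHS]normrM ler_wpM2l//.
    rewrite (ger0_norm (sqr_ge0 _)) normrM expr2.
    by apply: ler_pM => //; exact: coord_le_enorm.
  apply: le_trans (k_le yrr); rewrite normrM.
  by case: (i == j); rewrite ?normr1 ?normr0 ?mulr1 ?mulr0.
have r0 : 0 < enorm x by rewrite enorm_gt0.
have rr : 0 < enorm x < rho by rewrite r0.
apply: (continuousD (f := fun y => l (enorm y) * (y ord0 i * y ord0 j))
  (g := fun y => k (enorm y) * (i == j)%:R)).
  apply: (continuousM (s := fun y => l (enorm y)) (t := fun y => y ord0 i * y ord0 j)).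
    apply: continuous_enorm_comp.
    apply: (continuousM (s := fun r => h2 r - k r) (t := fun r => (r ^+ 2)^-1)).
      exact: (continuousB (ch2 rr) (continuous_k rr)).
    apply: (continuousV (s := fun r : R => r ^+ 2)); last exact: exprn_continuous.
    by rewrite expf_eq0/= gt_eqF.
  exact: (continuousM (@continuous_coord i x) (@continuous_coord j x)).
apply: (continuousM (s := fun y => k (enorm y)) (t := fun=> (i == j)%:R)).
  exact/continuous_enorm_comp/continuous_k.
exact: cst_continuous.
Qed.

Let continuous_partial (i : 'I_N) x : enorm x < rho ->
  {for x, continuous (partial i z)}.
Proof.
move=> xr; apply: (near_eq_continuous (g := dz i)).
  exact: near_partial_radial.
exact: continuous_dz.
Qed.

Let continuous_partial2 (i j : 'I_N) x : enorm x < rho ->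
  {for x, continuous (partial j (partial i z))}.
Proof.
move=> xr; apply: (near_eq_continuous (g := d2z i j)).
  by apply: filterS (near_ball xr) => y /(partial2_radial i j).
exact: continuous_d2z.
Qed.

Lemma radial_C2 : C2_on [set x : 'rV[R]_N | enorm x < rho] z.
Proof.
move=> x; rewrite /mkset => xr; split; first exact: radial_continuous.
- move=> i; split; last exact: continuous_partial.
  by have [] := is_derive_radial i xr.
- move=> i j; split; last exact: continuous_partial2.
  by have [] := is_derive_partial_radial i j xr.
Qed.

Lemma grad_radial x : enorm x < rho -> grad z x = k (enorm x) *: x.
Proof. by move=> xr; apply/rowP => i; rewrite !mxE partial_radial. Qed.

(** The trace of the Hessian; away from the origin it equals [h2 + (N - 1) * k]. *)
Lemma laplacian_radial x : enorm x < rho ->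
  laplacian z x = l (enorm x) * enorm x ^+ 2 + N%:R * k (enorm x).
Proof.
move=> xr; rewrite /laplacian.
under eq_bigr => i _ do rewrite partial2_radial// /d2z eqxx mulr1.
by rewrite big_split /= -mulr_sumr sumr_const card_ord enorm_sqr mulr_natl.
Qed.

End RadialFunction.

(** * The second derivative test at a maximum *)

Section MaximumPrinciple.
Context {R : realType}.

(** The first derivative vanishes at the maximum. If [a] were positive, the Caratheodory slope of
    [df] would be positive near [0], so [df > 0] just to the right of [0] and [f] would exceed [f 0]
    there. *)
Lemma second_derivative_local_max (f df : R -> R) (d a : R) : 0 < d ->
  (forall t : R, `|t| < d -> is_derive t 1 f (df t)) ->
  is_derive (0 : R) 1 df a ->
  (forall t : R, `|t| < d -> f t <= f 0) -> a <= 0.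
Proof.
move=> d0 fd dfa fmax.
have in_d t : t \in `]- d, d[ -> `|t| < d.
  by rewrite in_itv/= => /andP[? ?]; rewrite ltr_norml; apply/andP.
have df0 : df 0 = 0.
  have [||||_ E] := @derive1_at_max R f (- d) d 0.
  - by lra.
  - by move=> t /in_d /fd [].
  - by rewrite in_itv/= oppr_lt0 d0.
  - by move=> t /in_d /fmax.
  have D := fd 0; rewrite normr0 in D.
  by rewrite -[RHS]E (@derive_val _ _ _ _ _ _ _ (D d0)).
rewrite leNgt; apply/negP => a0.
have /is_derive1_caratheodory[q [qE qc q0]] := dfa.
have : \forall t \near (0 : R), 0 < q t.
  by apply: (cvgr_gt (q 0) qc); rewrite q0.
move=> /nbhs_ballP[e /= e0 He].
pose t := Num.min d e / 2.
have t0 : 0 < t by rewrite divr_gt0// lt_min d0.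
have td : t < d by rewrite /t; have := ge_min d d e; rewrite lexx /= => ?; lra.
have te : t < e by rewrite /t; have := ge_min e d e; rewrite lexx orbT => ?; lra.
have [||s] := @MVT R f df 0 t t0.
- move=> s; rewrite in_itv/= => /andP[s0 st]; apply: fd.
  by rewrite gtr0_norm// (lt_trans st).
- apply: derivable_within_continuous => s; rewrite in_itv/= => /andP[s0 st].
  by have [] := fd s; rewrite // ger0_norm// (le_lt_trans st).
rewrite in_itv/= => /andP[s0 st] E.
have : 0 < f t - f 0.
  rewrite E subr0; apply: mulr_gt0 => //.
  have -> : df s = q s * s by have := qE s; rewrite df0 !subr0.
  rewrite mulr_gt0//; apply: He.
  by rewrite /ball /= sub0r normrN gtr0_norm// (lt_trans st).
by rewrite subr_gt0 ltNge fmax// gtr0_norm.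
Qed.

Lemma is_derive_line (V : normedModType R) (f : V -> R) (x v : V) (t df : R) :
  is_derive (t *: v + x) v f df ->
  is_derive t 1 (fun s : R => f (s *: v + x)) df.
Proof.
have E : (fun h : R => h^-1 *:
     (((fun s : R => f (s *: v + x)) \o shift t) (h *: (1 : R)) - f (t *: v + x))) =
   (fun h => h^-1 *: ((f \o shift (t *: v + x)) (h *: v) - f (t *: v + x))).
  by apply/funext => h /=; rewrite [h *: 1]mulr1 scalerDl addrA.
by move=> [D1 D2]; split; rewrite ?/derivable ?/derive E.
Qed.

(** Restriction to the line through [x] in the direction [v] reduces the claim to one variable. *)
Lemma second_derivative_max (V : normedModType R) (f df : V -> R) (x v : V)
    (a : R) (U : set V) : nbhs x U ->
  (forall y, U y -> is_derive y v f (df y)) -> is_derive x v df a ->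
  (forall y, U y -> f y <= f x) -> a <= 0.
Proof.
move=> xU fd dfa fmax.
have : \forall t \near (0 : R), U (t *: v + x).
  have c : (fun t : R => t *: v + x) @ (0 : R) --> 0 *: v + x.
    apply: cvgD; last exact: cvg_cst.
    exact: scalel_continuous.
  by apply: c; rewrite scale0r add0r.
move=> /nbhs_ballP[d /= d0 Hd].
have {}Hd t : `|t| < d -> U (t *: v + x).
  by move=> td; apply: Hd; rewrite /ball /= sub0r normrN.
apply: (@second_derivative_local_max (fun t => f (t *: v + x))
  (fun t => df (t *: v + x)) d) => //.
- by move=> t /Hd /fd; exact: is_derive_line.
- by apply: is_derive_line; rewrite scale0r add0r.
- by move=> t /Hd; rewrite scale0r add0r; exact: fmax.
Qed.

End MaximumPrinciple.

(** * Uniqueness for the boundary value problem by the Hopf-Cole transform *)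

Section Comparison.
Context {R : realType} {N : nat}.
Variables (sigma rho Z0 : R) (b : R -> R).
Hypothesis N_ge1 : (1 <= N)%N.
Hypothesis sigma_gt0 : 0 < sigma.
Hypothesis rho_gt0 : 0 < rho.
Hypothesis b_ge0 : forall s, 0 <= s -> 0 <= b s.

(** With this [a], the squared gradient and the Laplacian of [z] enter the sum of the [d2hc z i] in
    the proportion of the equation. Here [dhc] and [d2hc] are the first and the pure second partial
    derivatives of [hopf_cole z]. *)
Let a : R := - (2 * sigma ^+ 2)^-1.
Let hopf_cole (z : 'rV[R]_N -> R) x := expR (a * z x).
Let dhc z i x := hopf_cole z x * (a * partial i z x).
Let d2hc z i x := hopf_cole z x *
  (a ^+ 2 * partial i z x ^+ 2 + a * partial i (partial i z) x).

Let is_derive_hc z i x :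
  derivable z x (delta_mx ord0 i) ->
  is_derive x (delta_mx ord0 i) (hopf_cole z) (dhc z i x).
Proof.
move=> /derivableP dz.
exact: (is_derive_comp (f := fun x => a * z x) (is_derive_expR _)
  (is_derive_scale a dz)).
Qed.

Let is_derive_dhc z i x :
  derivable z x (delta_mx ord0 i) ->
  derivable (partial i z) x (delta_mx ord0 i) ->
  is_derive x (delta_mx ord0 i) (dhc z i) (d2hc z i x).
Proof.
move=> dz /derivableP d2z.
apply: is_derive_eq (is_derive_mul (is_derive_hc dz) (is_derive_scale a d2z)) _.
by rewrite /d2hc /dhc -/(partial _ _ _) -/(partial _ (partial i z) x); ring.
Qed.

Lemma sqr_enorm_grad (z : 'rV[R]_N -> R) x :
  enorm (grad z x) ^+ 2 = \sum_(i < N) partial i z x ^+ 2.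
Proof.
by rewrite enorm_sqr; apply: eq_bigr => i _; rewrite !mxE expr2.
Qed.

Let hopf_cole_linear z x : HJB_solution sigma rho Z0 b z -> enorm x < rho ->
  \sum_(i < N) d2hc z i x = b (enorm x) / sigma ^+ 4 * hopf_cole z x.
Proof.
move=> [_ _ pde _] xr; rewrite -mulr_sumr mulrC; congr (_ * _).
rewrite big_split /= -!mulr_sumr -sqr_enorm_grad -/(laplacian z x).
have /= := pde x xr; set g := enorm (grad z x) ^+ 2; set L := laplacian _ _ => E.
have {E} -> : b (enorm x) = g / 4 - sigma ^+ 2 / 2 * L by lra.
by rewrite /a; field; rewrite gt_eqF.
Qed.

(** Otherwise the difference of the transforms plus a small multiple of [dot y y] has an interior
    maximum at which that difference is positive. The Laplacian there is nonpositive by the second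
    derivative test and positive by the linear equation. *)
Let hopf_cole_le z1 z2 x :
  HJB_solution sigma rho Z0 b z1 -> HJB_solution sigma rho Z0 b z2 ->
  enorm x < rho -> hopf_cole z1 x <= hopf_cole z2 x.
Proof.
move=> S1 S2 xr; have [C1 cz1 _ bd1] := S1; have [C2 cz2 _ bd2] := S2.
rewrite leNgt; apply/negP => lt12.
pose m := hopf_cole z1 x - hopf_cole z2 x.
have m0 : 0 < m by rewrite subr_gt0.
(* This makes the quadratic term at most [m / 2] on the closed ball, too small to account for the
   value [m] by itself. *)
pose eps := m / (2 * rho ^+ 2).
have eps0 : 0 < eps by rewrite divr_gt0// mulr_gt0// exprn_gt0.
pose e y := hopf_cole z1 y - hopf_cole z2 y + eps * dot y y.
have epsE (y : 'rV[R]_N) : enorm y <= rho -> eps * dot y y <= m / 2.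
  move=> yr; rewrite -enorm_sqr.
  have -> : m / 2 = eps * rho ^+ 2.
    by rewrite /eps; field; rewrite gt_eqF.
  by rewrite ler_pM2l// lerXn2r ?nnegrE ?enorm_ge0// ltW.
have ce : {within [set y | enorm y <= rho], continuous e}.
  have chc z : {within [set y | enorm y <= rho], continuous z} ->
      {within [set y | enorm y <= rho], continuous (hopf_cole z)}.
    move=> cz; apply: (@within_continuous_comp _ _ _ _ z (fun r => expR (a * r))) cz => r _.
    apply: (@continuous_comp _ _ _ ( *%R a) expR).
      exact: mulrl_continuous.
    exact: continuous_expR.
  have cdot : continuous (fun y : 'rV[R]_N => eps * dot y y).
    rewrite (_ : (fun y => eps * dot y y) = (fun y => eps * (enorm y * enorm y))).
      have ce2 : continuous (fun y : 'rV[R]_N => enorm y * enorm y).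
        move=> y; exact: (continuousM (@enorm_continuous R N y)
          (@enorm_continuous R N y)).
      by move=> y; apply: (continuousM (s := fun=> eps) _ (ce2 y)); exact: cst_continuous.
    by apply/funext => ?; rewrite -enorm_sqr expr2.
  apply: (@within_continuousD _ _ _ _ (fun y => hopf_cole z1 y - hopf_cole z2 y)
    (fun y => eps * dot y y)); last exact: continuous_subspaceT.
  exact: (@within_continuousB _ _ _ _ (hopf_cole z1) (hopf_cole z2)
    (chc _ cz1) (chc _ cz2)).
have [|c] := EVT_max_rV _ (@compact_enorm_le R N rho) ce.
  by exists x; exact: ltW.
rewrite inE /= => cr cmax.
have {}cmax y : enorm y <= rho -> e y <= e c by move=> yr; apply: cmax; rewrite inE.
have ec : m <= e c.
  apply: le_trans (cmax x (ltW xr)).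
  by rewrite /e lerDl mulr_ge0 ?dotxx_ge0// ltW.
(* The difference of the transforms is at least [m / 2] at [c]. This excludes the boundary, where
   both transforms take the same value. *)
have vc : 0 < hopf_cole z1 c - hopf_cole z2 c.
  by have := epsE c cr; move: ec; rewrite /e; lra.
have {}cr : enorm c < rho.
  rewrite lt_neqAle cr andbT; apply/eqP => crho.
  by move: vc; rewrite /hopf_cole bd1// bd2// subrr ltxx.
have openU : nbhs c [set y : 'rV[R]_N | enorm y < rho].
  by have := @open_enorm_lt R N rho; rewrite openE; apply.
have D2 (i : 'I_N) : d2hc z1 i c - d2hc z2 i c + eps * 2 <= 0.
  apply: (@second_derivative_max _ _ e
    (fun y => dhc z1 i y - dhc z2 i y + eps * (2 * y ord0 i))
    c (delta_mx ord0 i) _ _ openU).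
  - move=> y yr; have [_ dz1 _] := C1 y yr; have [_ dz2 _] := C2 y yr.
    apply: is_derive_add.
      by apply: is_derive_sub; apply: is_derive_hc; [have [] := dz1 i|have [] := dz2 i].
    exact: (is_derive_scale eps (is_derive_dotxx i y)).
  - have [_ dz1 d2z1] := C1 c cr; have [_ dz2 d2z2] := C2 c cr.
    apply: is_derive_add.
      apply: is_derive_sub; apply: is_derive_dhc.
      - by have [] := dz1 i.
      - by have [] := d2z1 i i.
      - by have [] := dz2 i.
      - by have [] := d2z2 i i.
    have D := is_derive_scale eps (is_derive_scale 2
      (is_derive_coord i c (delta_mx ord0 i))).
    by apply: is_derive_eq D _; rewrite mxE !eqxx mulr1.
  - by move=> y /ltW; exact: cmax.
(* The zeroth-order term contributes [q * (v1 - v2) >= 0], and the quadratic one contributes [N]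
   copies of [t], a positive amount because [N >= 1]. *)
have sumE (f g : 'I_N -> R) (q v1 v2 t : R) :
    \sum_i f i = q * v1 -> \sum_i g i = q * v2 -> 0 <= q -> 0 < v1 - v2 -> 0 < t ->
    0 < \sum_i (f i - g i + t).
  move=> E1 E2 q0 v0 t0; rewrite big_split /= sumrB sumr_const card_ord E1 E2 -mulrBr.
  by rewrite ltr_wpDl ?pmulrn_lgt0// mulr_ge0// ltW.
have := sumE _ _ _ _ _ (eps * 2) (hopf_cole_linear S1 cr) (hopf_cole_linear S2 cr).
rewrite divr_ge0 ?exprn_ge0 ?b_ge0 ?enorm_ge0 ?(ltW sigma_gt0)//.
move=> /(_ isT vc (mulr_gt0 eps0 (ltr0Sn _ 1))).
by rewrite ltNge => /negP; apply; apply: sumr_le0 => i _; exact: D2.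
Qed.

(** Comparison in both directions equates the transforms inside the ball; [expR] is injective and
    [a] is nonzero. *)
Lemma HJB_unique (z1 z2 : 'rV[R]_N -> R) x :
  HJB_solution sigma rho Z0 b z1 -> HJB_solution sigma rho Z0 b z2 ->
  enorm x <= rho -> z1 x = z2 x.
Proof.
move=> S1 S2; rewrite le_eqVlt => /predU1P[xr|xr].
  by have [_ _ _ ->//] := S1; have [_ _ _ ->//] := S2.
have /eqP : hopf_cole z1 x = hopf_cole z2 x.
  by apply/eqP; rewrite eq_le !hopf_cole_le.
rewrite /hopf_cole => /eqP /expR_inj /mulfI; apply.
by rewrite /a oppr_eq0 invr_eq0 mulf_neq0// expf_neq0// gt_eqF.
Qed.

Lemma grad_near_eq (z1 z2 : 'rV[R]_N -> R) x : {near x, z1 =1 z2} ->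
  grad z1 x = grad z2 x.
Proof.
by move=> z12; apply/rowP => i; rewrite !mxE /partial (near_eq_derive _ z12).
Qed.

End Comparison.

(** * Minimization over controls, by completing the square around [feedback z x] *)

Lemma HJB_expr_feedback (R : realType) (N : nat) (sigma : R) (b : R -> R)
    (z : 'rV[R]_N -> R) x p :
  HJB_expr sigma b z x p =
  HJB_expr sigma b z x (feedback z x) + enorm (p - feedback z x) ^+ 2.
Proof.
rewrite /HJB_expr /feedback; set g := grad z x; set L := laplacian z x.
have dotDr (q q1 q2 : 'rV[R]_N) : dot q (q1 + q2) = dot q q1 + dot q q2.
  by rewrite dotC dotDl !(dotC _ q).
have dotZr c (q q1 : 'rV[R]_N) : dot q (c *: q1) = c * dot q q1.
  by rewrite dotC dotZl dotC.
have -> : p - - (1 / 2) *: g = p + (1 / 2) *: g by rewrite scaleNr opprK.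
rewrite !enorm_sqr !dotDl !dotDr !dotZl !dotZr (dotC g p).
by field.
Qed.

Lemma HJB_expr_minimizer (R : realType) (N : nat) (sigma : R) (b : R -> R)
    (z : 'rV[R]_N -> R) x p : p != feedback z x ->
  HJB_expr sigma b z x (feedback z x) < HJB_expr sigma b z x p.
Proof.
move=> pz; rewrite [ltRHS]HJB_expr_feedback ltrDl exprn_gt0//.
by rewrite enorm_gt0 subr_eq0.
Qed.

(** * The value function built from the radial solution [u] *)

Section HopfColeSolution.
Context {R : realType} {N : nat}.
Variables (sigma rho Z0 : R) (b u : R -> R).
Hypothesis N_ge1 : (1 <= N)%N.
Hypothesis sigma_gt0 : 0 < sigma.
Hypothesis rho_gt0 : 0 < rho.
Hypothesis b_ge0 : forall s, 0 <= s -> 0 <= b s.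
Hypothesis b_cont : {within `[0, +oo[%classic, continuous b}.
Hypothesis b_nondecr : forall s t, 0 <= s -> s <= t -> b s <= b t.
Hypothesis b_bound : forall s, 0 < s -> 0 < b s /\ b s <= s ^+ 2.
Hypothesis u_sol : radial_solution N sigma rho Z0 b u.

Let A : set R := `[0, rho]%classic.
Let u1 : R -> R := derive_within A u.
Let B r := b r / sigma ^+ 4.
Let m := N.-1.
Let C := (sigma ^+ 4)^-1.
Let w r := u1 r / u r.
Let phi r := B r - m%:R / r * w r - w r ^+ 2.
(** On the open interval [h1] and [h2] are the first two derivatives of [h], written through [w] and
    its derivative [phi]. *)
Let h r := - 2 * sigma ^+ 2 * ln (u r).
Let h1 r : R := - 2 * sigma ^+ 2 * w r.
Let h2 r : R := - 2 * sigma ^+ 2 * phi r.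
Let z (x : 'rV[R]_N) := h (enorm x).

Let s2_gt0 : 0 < sigma ^+ 2. Proof. exact: exprn_gt0. Qed.
Let s4_gt0 : 0 < sigma ^+ 4. Proof. exact: exprn_gt0. Qed.

Let inA r : 0 <= r <= rho -> r \in A.
Proof. by move=> rr; rewrite inE /A /= in_itv. Qed.

Let nbhsA r : 0 < r < rho -> nbhs r A.
Proof.
move=> rr; have O : open (`]0, rho[%classic : set R) by exact: interval_open.
rewrite openE in O; apply: filterS (O r _); last by rewrite /= in_itv.
by apply: subset_itv; rewrite bnd_simp.
Qed.

Let itvW r : 0 < r < rho -> 0 <= r <= rho.
Proof. by move=> /andP[/ltW -> /ltW ->]. Qed.

Let u_gt0 r : 0 <= r <= rho -> 0 < u r.
Proof. by have [_ up _ _ _] := u_sol => /inA /up. Qed.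

Let cu : {within `[0, rho], continuous u}.
Proof. by have [[_ _ []]] := u_sol. Qed.

Let cu1 : {within `[0, rho], continuous u1}.
Proof. by have [[_ _ []]] := u_sol. Qed.

Let u10 : u1 0 = 0.
Proof. by have [_ _ _] := u_sol. Qed.

Let du r : 0 < r < rho -> is_derive r 1 u (u1 r).
Proof.
have [[du _ _] _ _ _ _] := u_sol => rr; apply: is_derive_within.
  exact: nbhsA.
by apply: du; exact/inA/itvW.
Qed.

Let du1 r : 0 < r < rho ->
  is_derive r 1 u1 (B r * u r - m%:R / r * u1 r).
Proof.
have [[_ du1 _] _ ode _ _] := u_sol => rr.
have D : is_derive r 1 u1 (derive_within A u1 r).
  by apply: is_derive_within; [exact: nbhsA|apply: du1; exact/inA/itvW].
apply: is_derive_eq D _.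
have /ode : r \in `]0, rho]%classic.
  by rewrite inE /= in_itv/=; case/andP: rr => -> /ltW.
have -> : N%:R - 1 = m%:R :> R by rewrite -(prednK N_ge1) -natr1 addrK.
by rewrite -/A -/u1 /B => /eqP; rewrite -subr_eq0 => /eqP E; lra.
Qed.

Let B_gt0 r : 0 < r -> 0 < B r.
Proof. by move=> /b_bound[? _]; rewrite divr_gt0. Qed.

Let B_nondecr r s : 0 <= r -> r <= s -> B r <= B s.
Proof. by move=> r0 rs; rewrite ler_pM2r ?invr_gt0// b_nondecr. Qed.

Let B_le r : 0 < r -> B r <= C * r ^+ 2.
Proof. by move=> /b_bound[_ ?]; rewrite /B /C [leLHS]mulrC ler_pM2l ?invr_gt0. Qed.

Let w_gt0 r : 0 < r <= rho -> 0 < w r.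
Proof. exact: (radial_logderive_gt0 u_gt0 cu1 du1 u10 B_gt0). Qed.

Let w_incr r s : 0 <= r -> r < s -> s <= rho -> w r < w s.
Proof.
exact: (radial_logderive_increasing rho_gt0 u_gt0 cu cu1 du du1 u10 B_gt0 B_nondecr).
Qed.

Let w_le r : 0 < r <= rho -> w r <= C * r ^+ 3.
Proof.
exact: (radial_logderive_le u_gt0 cu cu1 du du1 u10 B_gt0 B_nondecr B_le).
Qed.

Let dw r : 0 < r < rho -> is_derive r 1 w (phi r).
Proof. exact: (is_derive_logderive u_gt0 du du1). Qed.

Let phi_gt0 r : 0 < r <= rho -> 0 < phi r.
Proof.
exact: (radial_riccati_gt0 rho_gt0 u_gt0 cu cu1 du du1 u10 B_gt0 B_nondecr).
Qed.

Let phi_le r : 0 < r <= rho -> phi r <= B r.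
Proof. exact: (radial_riccati_le u_gt0 cu1 du1 u10 B_gt0). Qed.

Let w0 : w 0 = 0.
Proof. by rewrite /w u10 mul0r. Qed.

Lemma radial_solution_convex : convex_function (A : set R) u.
Proof.
exact: (radial_convex rho_gt0 u_gt0 cu cu1 du du1 u10 B_gt0 B_nondecr).
Qed.

Let is_derive_log r : 0 < u r ->
  is_derive (u r) 1 (fun y => - 2 * sigma ^+ 2 * ln y) (- 2 * sigma ^+ 2 * (u r)^-1).
Proof. by move=> u0; apply: is_derive_scale; exact: is_derive1_ln. Qed.

(** The chain rule within the closed interval also covers the endpoints, where the derivatives are
    one-sided. *)
Lemma derive_within_value r : 0 <= r <= rho ->
  derivable_within A h r /\ derive_within A h r = - 2 * sigma ^+ 2 * w r.
Proof.
move=> rr; have ur := u_gt0 rr; have [[du' _ _] _ _ _ _] := u_sol.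
apply: derivable_derive_within => //.
have -> : - 2 * sigma ^+ 2 * w r = - 2 * sigma ^+ 2 * (u r)^-1 * u1 r.
  by rewrite /w mulrA mulrAC.
apply: (cvg_within_comp (f := u) _ _ (is_derive_log ur)).
  by apply: cvg_within_dnbhs => //; rewrite /= in_itv.
by apply: cvg_within_derivable; apply: du'; exact: inA.
Qed.

Let dh r : 0 < r < rho -> is_derive r 1 h (h1 r).
Proof.
move=> /[dup] /nbhsA nA /itvW/derive_within_value[D E].
by rewrite /h1 -E; exact: is_derive_within.
Qed.

Let dh1 r : 0 < r < rho -> is_derive r 1 h1 (h2 r).
Proof. by move=> /dw; exact: is_derive_scale. Qed.

Let ch : {within `[0, rho], continuous h}.
Proof.
apply/subspace_continuousP => r; rewrite /= in_itv/= => rr.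
have /subspace_continuousP/(_ r) := cu; rewrite /= in_itv/= rr => /(_ isT) H.
apply: (@cvg_comp _ _ _ u (fun y => - 2 * sigma ^+ 2 * ln y) _ _ _ H).
have [D _] := is_derive_log (u_gt0 rr).
have : {for u r, continuous (fun y => - 2 * sigma ^+ 2 * ln y)}.
  exact/differentiable_continuous/derivable1_diffP.
by [].
Qed.

(** Continuity of [b] enters through [B], a summand of [phi]. At an interior point continuity within
    the half-line is ordinary continuity. *)
Let ch2 r : 0 < r < rho -> {for r, continuous h2}.
Proof.
move=> /[dup] rr /andP[r0 rrho].
have cwr : {for r, continuous w}.
  by have [D _] := dw rr; exact/differentiable_continuous/derivable1_diffP.
have cb : {for r, continuous b}.
  have /subspace_continuousP/(_ r) := b_cont.
  rewrite /= in_itv/= andbT (ltW r0) => /(_ isT).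
  rewrite within_interior//.
  have O : open (`]0, +oo[%classic : set R) by exact: interval_open.
  rewrite openE in O; apply: filterS (O r _); last by rewrite /= in_itv/= r0.
  by apply: subset_itv; rewrite bnd_simp.
apply: (continuousM (s := fun=> - 2 * sigma ^+ 2) (t := phi)).
  exact: cst_continuous.
apply: (continuousB (f := fun r => B r - m%:R / r * w r) (g := fun r => w r ^+ 2)).
  apply: (continuousB (f := B) (g := fun r => m%:R / r * w r)).
    by apply: (continuousM (s := b) cb); exact: cst_continuous.
  have ci : {for r, continuous (fun t : R => t^-1)}.
    by apply: inv_continuous; rewrite gt_eqF.
  have cm : {for r, continuous (fun t : R => m%:R / t)}.
    apply: (continuousM (s := fun=> (m%:R : R)) (t := fun t : R => t^-1) _ ci).
    exact: cst_continuous.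
  exact: (continuousM cm cwr).
rewrite (_ : (fun r => w r ^+ 2) = (fun r => w r * w r)).
  exact: (continuousM cwr cwr).
by apply/funext => t; rewrite expr2.
Qed.

Let C1 := 2 * sigma ^+ 2 * C.

Let C1_ge0 : 0 <= C1.
Proof. by rewrite !mulr_ge0 ?invr_ge0// ltW. Qed.

Let h1_le r : 0 < r < rho -> `|h1 r| <= C1 * r ^+ 3.
Proof.
move=> /andP[r0 rr]; have rr' : 0 < r <= rho by rewrite r0 ltW.
have -> : h1 r = - (2 * (sigma ^+ 2 * w r)) by rewrite /h1 !mulNr mulrA.
have -> : C1 * r ^+ 3 = 2 * (sigma ^+ 2 * (C * r ^+ 3)) by rewrite /C1 !mulrA.
rewrite normrN gtr0_norm; last first.
  by apply: mulr_gt0 => //; apply: mulr_gt0 => //; exact: w_gt0.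
by rewrite ler_pM2l// ler_pM2l// w_le.
Qed.

Let h2_le r : 0 < r < rho -> `|h2 r| <= C1 * r ^+ 2.
Proof.
move=> /andP[r0 rr]; have rr' : 0 < r <= rho by rewrite r0 ltW.
have -> : h2 r = - (2 * (sigma ^+ 2 * phi r)) by rewrite /h2 !mulNr mulrA.
have -> : C1 * r ^+ 2 = 2 * (sigma ^+ 2 * (C * r ^+ 2)) by rewrite /C1 !mulrA.
rewrite normrN gtr0_norm; last first.
  by apply: mulr_gt0 => //; apply: mulr_gt0 => //; exact: phi_gt0.
by rewrite ler_pM2l// ler_pM2l// (le_trans (phi_le rr'))// B_le.
Qed.

Let gradE x : enorm x < rho -> grad z x = (h1 (enorm x) / enorm x) *: x.
Proof. exact: (grad_radial rho_gt0 C1_ge0 dh ch h1_le). Qed.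

Lemma feedback_value x : enorm x < rho ->
  feedback z x = (sigma ^+ 2 * w (enorm x) / enorm x) *: x.
Proof.
move=> xr; rewrite /feedback gradE// scalerA; congr (_ *: _).
rewrite /h1; move: (w _) (enorm x)^-1 => v t. lra.
Qed.

Lemma enorm_feedback_value x : enorm x < rho ->
  enorm (feedback z x) = sigma ^+ 2 * w (enorm x).
Proof.
move=> xr; rewrite feedback_value// enormZ.
have [->|x0] := eqVneq x 0; first by rewrite enorm0 !mulr0 w0 mulr0.
have r0 : 0 < enorm x by rewrite enorm_gt0.
by rewrite gtr0_norm ?divfK ?gt_eqF// divr_gt0// mulr_gt0// w_gt0// r0 ltW.
Qed.

(** Monotonicity gives [b 0 <= b s <= s ^+ 2] for every [s > 0]. If [b 0 > 0], the choice
    [s = min 1 (b 0 / 2)] yields [b 0 <= s ^+ 2 <= s <= b 0 / 2], a contradiction. *)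
Let b0 : b 0 = 0.
Proof.
apply/eqP; rewrite eq_le b_ge0// andbT leNgt; apply/negP => b0.
pose s := Num.min 1 (b 0 / 2).
have s0 : 0 < s by rewrite lt_min ltr01 divr_gt0.
have [_ bs] := b_bound s0.
have := le_trans (b_nondecr (lexx 0) (ltW s0)) bs.
apply/negP; rewrite -ltNge.
have s1 : s <= 1 by rewrite ge_min lexx.
have sb : s <= b 0 / 2 by rewrite ge_min lexx orbT.
have : s ^+ 2 <= s * 1 by rewrite expr2 ler_pM2l.
by lra.
Qed.

Lemma HJB_solution_value : HJB_solution sigma rho Z0 b z.
Proof.
split.
- exact: (radial_C2 rho_gt0 C1_ge0 dh dh1 ch ch2 h1_le h2_le).
- exact: radial_continuous_within.
- move=> x xr; rewrite gradE// enormZ exprMn real_normK ?num_real//.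
  rewrite (laplacian_radial rho_gt0 C1_ge0 dh dh1 ch h1_le)//.
  (* At the origin the gradient and the Laplacian vanish, so the equation reduces to [b 0 = 0].
     Elsewhere the definition of [phi] makes it an algebraic identity. *)
  have [->|x0] := eqVneq x 0.
    by rewrite enorm0 b0 invr0 !mulr0 expr0n /= !mulr0 addr0 subr0 mulr0.
  have r0 : enorm x != 0 by rewrite enorm_eq0.
  have -> : N%:R = m%:R + 1 :> R by rewrite natr1 prednK.
  by rewrite /h2 /h1 /phi /B; field; rewrite r0 gt_eqF.
- move=> x xr; rewrite /z /h xr.
  have [_ _ _ _ ->] := u_sol; rewrite expRK.
  by field; rewrite gt_eqF.
Qed.

(** The derivative of [- h] is [2 * sigma ^+ 2 * w], which increases with [w]. Concavity of [h] is
    expressed as convexity of [- h]. *)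
Lemma value_concave : convex_function (A : set R) (fun r => - h r).
Proof.
apply: (@nondecreasing_derive_convex R _ (fun r => - h1 r)).
- by move=> r /dh D; exact: is_deriveN.
- move=> r s r0; rewrite le_eqVlt => /predU1P[->//|rs] sr.
  rewrite /h1 !mulNr !opprK ler_pM2l ?mulr_gt0//.
  by apply/ltW/w_incr => //; exact: ltW.
- by move=> r; apply: continuousN; exact: ch.
Qed.

Lemma radial_logderive_incr r s : 0 <= r -> r < s -> s <= rho -> w r < w s.
Proof. exact: w_incr. Qed.

End HopfColeSolution.

Theorem theorem4p1 (R : realType) (N : nat) (sigma rho Z0 : R) (b u : R -> R)
  (N_ge1 : (1 <= N)%N) (sigma_gt0 : 0 < sigma) (rho_gt0 : 0 < rho)
  (b_ge0 : forall s, 0 <= s -> 0 <= b s)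
  (b_cont : {within `[0, +oo[%classic, continuous b})
  (b_nondecr : forall s t, 0 <= s -> s <= t -> b s <= b t)
  (b_bound : forall s, 0 < s -> 0 < b s /\ b s <= s ^+ 2)
  (u_sol : radial_solution N sigma rho Z0 b u) :
  let h : R -> R := fun r => - 2 * sigma ^+ 2 * ln (u r) in
  let z : 'rV[R]_N -> R := fun x => h (enorm x) in
  let h' : R -> R := derive_within `[0, rho]%classic h in
  let pstar : 'rV[R]_N -> 'rV[R]_N := feedback z in
  (* z is a classical solution of the boundary value problem, and pstar is the
     unique pointwise minimizer *)
  [/\ HJB_solution sigma rho Z0 b z,
      (forall x p, enorm x < rho -> p != pstar x ->
         HJB_expr sigma b z x (pstar x) < HJB_expr sigma b z x p),
  (* radial symmetry *)
      [/\ forall r, 0 <= r <= rho -> derivable_within `[0, rho]%classic h r,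
          forall x, enorm x < rho -> x != 0 ->
            pstar x = - (1 / 2) * h' (enorm x) *: ((enorm x)^-1 *: x)
        & pstar 0 = 0],
  (* monotonicity *)
      [/\ forall x, enorm x < rho -> enorm (pstar x) = - (1 / 2) * h' (enorm x),
          forall x y, enorm x < enorm y -> enorm y < rho ->
            enorm (pstar x) < enorm (pstar y),
          forall r s, 0 <= r -> r < s -> s <= rho ->
            - (1 / 2) * h' r < - (1 / 2) * h' s,
          convex_function (`[0, rho]%classic : set R) (fun r => - h r)
        & convex_function (`[0, rho]%classic : set R) u]
  (* uniqueness *)
    & forall z1, HJB_solution sigma rho Z0 b z1 ->
        (forall x, enorm x <= rho -> z1 x = z x) /\
        (forall x, enorm x < rho ->
           grad z1 x = grad z x /\ feedback z1 x = pstar x)].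
Proof.
move=> h z h' pstar.
pose w r := derive_within `[0, rho]%classic u r / u r.
(* Radial symmetry and strict monotonicity of the control reduce to [w]: the expression in [h'] is
   [sigma ^+ 2 * w] on the closed interval, and so is the magnitude of [pstar] inside the ball. *)
have hE r : 0 <= r <= rho -> - (1 / 2) * h' r = sigma ^+ 2 * w r.
  move=> /(derive_within_value rho_gt0 u_sol)[_ E].
  by have -> : h' r = - 2 * sigma ^+ 2 * w r := E; field.
have er (x : 'rV[R]_N) : enorm x < rho -> 0 <= enorm x <= rho.
  by move=> /ltW ->; rewrite enorm_ge0.
have pE x : enorm x < rho -> pstar x = (sigma ^+ 2 * w (enorm x) / enorm x) *: x.
  exact: (feedback_value N_ge1 sigma_gt0 rho_gt0 b_nondecr b_bound u_sol).
have npE x : enorm x < rho -> enorm (pstar x) = sigma ^+ 2 * w (enorm x).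
  exact: (enorm_feedback_value N_ge1 sigma_gt0 rho_gt0 b_nondecr b_bound u_sol).
have w_incr r s : 0 <= r -> r < s -> s <= rho -> w r < w s.
  exact: (radial_logderive_incr N_ge1 sigma_gt0 rho_gt0 b_nondecr b_bound u_sol).
have Sz : HJB_solution sigma rho Z0 b z.
  exact: (HJB_solution_value N_ge1 sigma_gt0 rho_gt0 b_ge0 b_cont b_nondecr
    b_bound u_sol).
have s2 : 0 < sigma ^+ 2 by exact: exprn_gt0.
split.
- exact: Sz.
- by move=> x p _; exact: HJB_expr_minimizer.
- split.
  + by move=> r /(derive_within_value rho_gt0 u_sol)[].
  + by move=> x xr _; rewrite hE ?er// scalerA pE.
  + by rewrite pE ?enorm0// scaler0.
- split.
  + by move=> x xr; rewrite npE// hE// er.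
  + move=> x y xy yr; rewrite !npE ?(lt_trans xy)// ltr_pM2l// w_incr ?enorm_ge0//.
    exact: ltW.
  + move=> r s r0 rs sr.
    by rewrite !hE ?r0 ?(ltW (le_lt_trans r0 rs)) ?(le_trans (ltW rs))// ltr_pM2l// w_incr.
  + exact: (value_concave N_ge1 sigma_gt0 rho_gt0 b_nondecr b_bound u_sol).
  + exact: (radial_solution_convex N_ge1 sigma_gt0 rho_gt0 b_nondecr b_bound u_sol).
- move=> z1 S1.
  have z1E x : enorm x <= rho -> z1 x = z x.
    exact: (HJB_unique N_ge1 sigma_gt0 rho_gt0 b_ge0 S1 Sz).
  split=> // x xr; have E : grad z1 x = grad z x.
    (* Equal gradients at [x] require agreement near [x], which the open ball provides. *)
    apply: grad_near_eq; have := @open_enorm_lt R N rho; rewrite openE => /(_ x xr).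
    by apply: filterS => y /ltW /z1E.
  by rewrite /pstar /feedback E.
Qed.
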